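(* The quantum groups $H_N\subset H_N^+$ have the same number of $1,2,3$-orbitals, when regarded as subgroups of $S_{2N}^+$, namely $1,3,11$ respectively.
   Context: $H_N^+$ is the free hyperoctahedral quantum group: $C(H_N^+)$ is the universal $C^*$-algebra generated by self-adjoint elements $u_{ij}$, $1\le i,j\le N$, such that $u=(u_{ij})$ satisfies $u^t=u^{-1}$ and such that the elements $p_{ij}=u_{ij}^2$ form a magic matrix (projections summing to $1$ on each row and column); $\Delta(u_{ij})=\sum_ku_{ik}\otimes u_{kj}$. The hyperoctahedral group $H_N\subset H_N^+$ of signed permutation matrices is its classical version. $S_{2N}^+$ is the quantum permutation group on $2N$ points. The embedding $H_N^+\subset S_{2N}^+$ (quantum symmetries of $N$ segments) is given by the $2N\times2N$ magic unitary $v=\begin{pmatrix} a & b \\ b & a \end{pmatrix}$, with $a_{ij}=(u_{ij}^2+u_{ij})/2$ and $b_{ij}=(u_{ij}^2-u_{ij})/2$; it restricts to the usual action $H_N\subset S_{2N}$ on the endpoints of $N$ segments. The number of (analytic) $k$-orbitals of a quantum subgroup $G\subset S_M^+$, with magic unitary $v$, is $\dim Fix(v^{\otimes k})=\int_G\chi^k$, where $\chi=\sum_iv_{ii}$ and $\int_G$ is the Haar state; for classical groups this is the number of orbits of $G$ on $\{1,\ldots,M\}^k$.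
   Formalization: Equality of the numbers of 1,2,3-orbitals is proved for every N, but the values 1, 3, 11 are asserted only for N≥1, N≥2, N≥3 respectively, since they fail otherwise (H_1 has 1,2,4 and H_2 has 1,3,10 orbitals). *)

(* Defs.v *)
From HB Require Import structures.
From mathcomp Require Import all_boot all_order all_algebra all_fingroup.
From mathcomp Require Import complex lra.
From mathcomp Require Import all_classical all_reals all_analysis.

Set Implicit Arguments.
Unset Strict Implicit.
Unset Printing Implicit Defensive.

Import Order.TTheory GRing.Theory Num.Theory.
Import numFieldNormedType.Exports ComplexField.Normc.

Local Open Scope ring_scope.

(* Unital C*-algebras.  Mathcomp-Analysis has no joint structure of normed
   module and ring (its normed modules and the numDomainType hierarchy have no
   common join), so the real-valued norm and its completeness are spelled out
   here. *)
HB.mixin Record isCStar (R : realType) A of GRing.Algebra R[i] A := {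
  star : A -> A;
  cnorm : A -> R;
  starK : involutive star;
  starD : {morph star : x y / x + y};
  starZ : forall (a : R[i]) (x : A), star (a *: x) = (a^*)%C *: star x;
  starM : forall x y : A, star (x * y) = star y * star x;
  cnorm_eq0 : forall x : A, cnorm x = 0 -> x = 0;
  cnormD : forall x y : A, cnorm (x + y) <= cnorm x + cnorm y;
  cnormZ : forall (a : R[i]) (x : A), cnorm (a *: x) = normc a * cnorm x;
  cnormM : forall x y : A, cnorm (x * y) <= cnorm x * cnorm y;
  cnorm_star : forall x : A, cnorm (star x * x) = cnorm x ^+ 2;
  cnorm_complete : forall s : nat -> A,
    (forall e : R, 0 < e -> exists n0 : nat, forall m n : nat,
       (n0 <= m)%N -> (n0 <= n)%N -> cnorm (s m - s n) < e) ->
    exists l : A, forall e : R, 0 < e -> exists n0 : nat, forall n : nat,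
       (n0 <= n)%N -> cnorm (s n - l) < e
}.

#[short(type="cstarAlgType")]
HB.structure Definition CStarAlgebra (R : realType) :=
  {A of GRing.Algebra R[i] A & isCStar R A}.

Section Orbitals.
Variables (R : realType) (A : cstarAlgType R) (M : nat).
Implicit Types (v : 'M[A]_M) (k : nat).

Definition tensor_power v k (i j : k.-tuple 'I_M) : A :=
  \prod_(l < k) v (tnth i l) (tnth j l).

(* Fix(v^{(x)k}) = {xi in (C^M)^{(x)k} | v^{(x)k} (xi (x) 1) = xi (x) 1}. *)
Definition fixed_vector v k (xi : {ffun k.-tuple 'I_M -> R[i]^o}) : Prop :=
  forall i, \sum_j xi j *: tensor_power v i j = xi i *: 1.

(* The predicate fixed_vector is not decidable a priori, so that the
   corresponding {vspace _} is obtained by choice; see mem_Fix. *)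
Definition Fix v k : {vspace {ffun k.-tuple 'I_M -> R[i]^o}} :=
  xget 0%VS [set F : {vspace {ffun k.-tuple 'I_M -> R[i]^o}} |
             forall xi, xi \in F <-> fixed_vector v xi].

Definition num_orbitals v k : nat := \dim (Fix v k).

Lemma fixed_vector0 v k : @fixed_vector v k 0.
Proof.
by move=> i; rewrite ffunE scale0r big1 // => j _; rewrite ffunE scale0r.
Qed.

Lemma fixed_vectorP v k a (x y : {ffun k.-tuple 'I_M -> R[i]^o}) :
  fixed_vector v x -> fixed_vector v y -> fixed_vector v (a *: x + y).
Proof.
move=> hx hy i; rewrite !ffunE scalerDl -scalerA -hx -hy scaler_sumr.
by rewrite -big_split; apply: eq_bigr => j _; rewrite !ffunE scalerDl -scalerA.
Qed.

Lemma mem_Fix v k xi : xi \in Fix v k <-> fixed_vector v xi.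
Proof.
rewrite /Fix; case: xgetP => [F _ //|].
pose ok (F : {vspace {ffun k.-tuple 'I_M -> R[i]^o}}) :=
  `[< forall x, x \in F -> fixed_vector v x >].
pose P n := `[< exists F, ok F /\ \dim F = n >].
have P0 : exists n, P n.
  exists 0%N; apply/asboolP; exists 0%VS; split; last exact: dimv0.
  by apply/asboolP => x; rewrite memv0 => /eqP->; exact: fixed_vector0.
have Pb n : P n -> (n <= \dim {:{ffun k.-tuple 'I_M -> R[i]^o}})%N.
  by move=> /asboolP[F [_ <-]]; apply/dimvS/subvf.
case: (ex_maxnP P0 Pb) => n /asboolP[F [/asboolP okF dF]] maxn /(_ F) [].
move=> x; split=> [/okF //|fx]; apply/negPn/negP => xF.
have : P n.+1.
  apply/asboolP; exists (F + <[x]>)%VS; split.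
    apply/asboolP => y /memv_addP[y1 /okF fy [_ /vlineP[a ->] ->]].
    by rewrite addrC; apply: fixed_vectorP.
  rewrite dimv_disjoint_sum ?dF ?dim_vline; last first.
    apply/eqP; rewrite -subv0; apply/subvP => y.
    rewrite memv_cap => /andP[yF /vlineP[a ya]]; move: yF; rewrite ya memv0.
    have [->|a0] := eqVneq a 0; first by rewrite scale0r.
    by rewrite rpredZeq (negPf a0) (negPf xF).
  have -> : (x != 0) = true by apply: contraNneq xF => ->; rewrite mem0v.
  by rewrite addn1.
by move/maxn; rewrite ltnn.
Qed.

End Orbitals.

Section QuantumHyperoctahedral.
Variables (R : realType) (A : cstarAlgType R).

Definition projection (p : A) : Prop := p * p = p /\ star p = p.

Definition magic (M : nat) (p : 'M[A]_M) : Prop :=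
  [/\ forall i j, projection (p i j),
      forall i, \sum_j p i j = 1
    & forall j, \sum_i p i j = 1].

Definition hyperoct_relations (N : nat) (u : 'M[A]_N) : Prop :=
  [/\ forall i j, star (u i j) = u i j,
      u *m u^T = 1%:M,
      u^T *m u = 1%:M
    & magic (\matrix_(i, j) u i j ^+ 2)].

(* The magic unitary of the quantum symmetries of N segments: lshift N i and
   rshift N i index the two endpoints of the i-th segment. *)
Definition segment_magic (N : nat) (u : 'M[A]_N) : 'M[A]_(N + N) :=
  let a := \matrix_(i, j) ((2%:R^-1 : R[i]) *: (u i j ^+ 2 + u i j)) in
  let b := \matrix_(i, j) ((2%:R^-1 : R[i]) *: (u i j ^+ 2 - u i j)) in
  block_mx a b b a.

End QuantumHyperoctahedral.

(* (A, u) is the universal C*-algebra C(H_N^+) with its standard generators,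
   up to isomorphism. *)
Definition is_C_free_hyperoct (R : realType) (N : nat) (A : cstarAlgType R)
    (u : 'M[A]_N) : Prop :=
  hyperoct_relations u /\
  forall (B : cstarAlgType R) (w : 'M[B]_N), hyperoct_relations w ->
    exists f : {lrmorphism A -> B},
      [/\ forall x, f (star x) = star (f x),
          forall i j, f (u i j) = w i j
        & forall g : {lrmorphism A -> B},
            (forall x, g (star x) = star (g x)) ->
            (forall i j, g (u i j) = w i j) -> g =1 f].

(* The signed permutation matrix of (s, e) is
   \sum_i (-1)^{e i} E_{i, s i}; each one arises from a unique pair. *)
Definition hyperoct (N : nat) : Type := ('S_N * {ffun 'I_N -> bool})%type.
HB.instance Definition _ N := Finite.on (hyperoct N).

Definition signed_perm_mx (R : realType) (N : nat) (g : hyperoct N) :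
    'M[R[i]]_N := \matrix_(i, j) ((-1) ^+ g.2 i *+ (g.1 i == j)).

(* C(H_N): the functions on H_N, with pointwise operations and sup norm. *)
Definition C_hyperoct (R : realType) (N : nat) : Type :=
  {ffun hyperoct N -> R[i]^o}.

Section CHyperoct.
Variables (R : realType) (N : nat).
Local Notation CH := (C_hyperoct R N).

HB.instance Definition _ :=
  GRing.Lmodule.copy CH {ffun hyperoct N -> R[i]^o}.
HB.instance Definition _ :=
  GRing.PzRing.copy CH {ffun hyperoct N -> R[i]^o}.
HB.instance Definition _ := GRing.PzSemiRing_isNonZero.Build CH
  (@ffun1_nonzero (hyperoct N) R[i] ((1%g : 'S_N), [ffun => false])).

Fact C_hyperoct_scaleAl (a : R[i]) (f g : CH) : a *: (f * g) = a *: f * g.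
Proof. by apply/ffunP => x; rewrite !ffunE /= scalerAl. Qed.
Fact C_hyperoct_scaleAr (a : R[i]) (f g : CH) : a *: (f * g) = f * (a *: g).
Proof. by apply/ffunP => x; rewrite !ffunE /= scalerAr. Qed.
HB.instance Definition _ :=
  GRing.Lmodule_isLalgebra.Build R[i] CH C_hyperoct_scaleAl.
HB.instance Definition _ :=
  GRing.Lalgebra_isAlgebra.Build R[i] CH C_hyperoct_scaleAr.

Definition C_hyperoct_star (f : CH) : CH := [ffun g => ((f g)^*)%C].
Definition C_hyperoct_norm (f : CH) : R :=
  \big[Num.max/0]_(g : hyperoct N) normc (f g : R[i]).

Local Notation nrm := C_hyperoct_norm.

Fact C_hyperoct_norm_ge (f : CH) g : normc (f g : R[i]) <= nrm f.
Proof. exact: le_bigmax. Qed.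

Fact C_hyperoct_norm_le (f : CH) (c : R) : 0 <= c ->
  (forall g, normc (f g : R[i]) <= c) -> nrm f <= c.
Proof. by move=> c0 fc; apply: bigmax_le. Qed.

Fact normc_ge0 (z : R[i]) : 0 <= normc z.
Proof. by case: z => a b; exact: sqrtr_ge0. Qed.

Fact C_hyperoct_norm_ge0 (f : CH) : 0 <= nrm f.
Proof. by rewrite (le_trans _ (C_hyperoct_norm_ge f (1%g, [ffun => false]))) ?normc_ge0. Qed.

Fact C_hyperoct_starK : involutive C_hyperoct_star.
Proof. by move=> f; apply/ffunP => g; rewrite !ffunE conjcK. Qed.

Fact C_hyperoct_starD : {morph C_hyperoct_star : x y / x + y}.
Proof. by move=> f h; apply/ffunP => g; rewrite !ffunE rmorphD. Qed.

Fact C_hyperoct_starZ (a : R[i]) (f : CH) :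
  C_hyperoct_star (a *: f) = (a^*)%C *: C_hyperoct_star f.
Proof. by apply/ffunP => g; rewrite !ffunE rmorphM. Qed.

Fact C_hyperoct_starM (f h : CH) :
  C_hyperoct_star (f * h) = C_hyperoct_star h * C_hyperoct_star f.
Proof. by apply/ffunP => g; rewrite !ffunE rmorphM mulrC. Qed.

Fact C_hyperoct_norm_eq0 (f : CH) : nrm f = 0 -> f = 0.
Proof.
move=> f0; apply/ffunP => g; rewrite ffunE; apply: eq0_normc; apply/eqP.
by rewrite eq_le normc_ge0 andbT -f0 C_hyperoct_norm_ge.
Qed.

Fact C_hyperoct_normD (f h : CH) : nrm (f + h) <= nrm f + nrm h.
Proof.
apply: C_hyperoct_norm_le => [|g]; first by rewrite addr_ge0 ?C_hyperoct_norm_ge0.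
by rewrite ffunE (le_trans (le_normcD _ _)) ?lerD ?C_hyperoct_norm_ge.
Qed.

Fact C_hyperoct_normZ (a : R[i]) (f : CH) : nrm (a *: f) = normc a * nrm f.
Proof.
rewrite /nrm (big_morph _ (fun x y => maxr_pMr x y (normc_ge0 a)) (mulr0 _)).
by apply: eq_bigr => g _; rewrite ffunE normcM.
Qed.

Fact C_hyperoct_normM (f h : CH) : nrm (f * h) <= nrm f * nrm h.
Proof.
apply: C_hyperoct_norm_le => [|g]; first by rewrite mulr_ge0 ?C_hyperoct_norm_ge0.
by rewrite ffunE normcM ler_pM ?normc_ge0 ?C_hyperoct_norm_ge.
Qed.

Fact C_hyperoct_norm_star (f : CH) : nrm (C_hyperoct_star f * f) = nrm f ^+ 2.
Proof.
have e g : normc ((C_hyperoct_star f * f) g : R[i]) = normc (f g : R[i]) ^+ 2.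
  by rewrite !ffunE normcM expr2; case: (f g) => a b; rewrite /normc /= sqrrN.
apply/eqP; rewrite eq_le; apply/andP; split.
  apply: C_hyperoct_norm_le => [|g]; first by rewrite exprn_ge0 ?C_hyperoct_norm_ge0.
  by rewrite e ler_pXn2r ?nnegrE ?normc_ge0 ?C_hyperoct_norm_ge0 ?C_hyperoct_norm_ge.
rewrite -[leRHS]sqr_sqrtr ?C_hyperoct_norm_ge0// ler_pXn2r ?nnegrE ?C_hyperoct_norm_ge0 ?sqrtr_ge0//.
apply: C_hyperoct_norm_le => [|g]; first exact: sqrtr_ge0.
rewrite -[leLHS]ger0_norm ?normc_ge0// -sqrtr_sqr ler_wsqrtr // -e.
exact: C_hyperoct_norm_ge.
Qed.

Fact real_cauchy_seq (s : nat -> R) :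
  (forall e : R, 0 < e -> exists n0 : nat, forall m n : nat,
     (n0 <= m)%N -> (n0 <= n)%N -> `|s m - s n| < e) ->
  exists l : R, forall e : R, 0 < e -> exists n0 : nat, forall n : nat,
     (n0 <= n)%N -> `|s n - l| < e.
Proof.
move=> cs; have cvs : cvg (s @ \oo)%classic.
  apply/cauchy_cvgP/cauchy_exP => e e0.
  have [n0 h] := cs e e0; exists (s n0), n0 => // n /= hn.
  by rewrite /ball /= h.
exists (limn s) => e e0.
have /cvgrPdistC_lt/(_ e e0)[n0 _ h] := cvs.
by exists n0 => n hn; apply: h.
Qed.

Fact C_hyperoct_complete (s : nat -> CH) :
  (forall e : R, 0 < e -> exists n0 : nat, forall m n : nat,
     (n0 <= m)%N -> (n0 <= n)%N -> nrm (s m - s n) < e) ->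
  exists l : CH, forall e : R, 0 < e -> exists n0 : nat, forall n : nat,
     (n0 <= n)%N -> nrm (s n - l) < e.
Proof.
move=> cs.
have cR (p : R[i] -> R) : {morph p : x y / x - y} ->
    (forall z, `|p z| <= normc z) ->
    forall g, exists l : R, forall e : R, 0 < e -> exists n0 : nat,
      forall n : nat, (n0 <= n)%N -> `|p (s n g) - l| < e.
  move=> pB pn g; apply: real_cauchy_seq => e e0.
  have [n0 h] := cs e e0; exists n0 => m n hm hn.
  rewrite -pB (le_lt_trans (pn _))// (le_lt_trans _ (h m n hm hn))//.
  have -> : (s m g - s n g : R[i]) = (s m - s n) g by rewrite !ffunE.
  exact: C_hyperoct_norm_ge.
have ReB : {morph (@complex.Re R) : x y / x - y} by move=> [? ?] [? ?].
have ImB : {morph (@complex.Im R) : x y / x - y} by move=> [? ?] [? ?].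
have Ren (z : R[i]) : `|complex.Re z| <= normc z.
  by case: z => x y; rewrite /= -sqrtr_sqr ler_wsqrtr// lerDl sqr_ge0.
have Imn (z : R[i]) : `|complex.Im z| <= normc z.
  by case: z => x y; rewrite /= -sqrtr_sqr ler_wsqrtr// lerDr sqr_ge0.
have /choice[lr hr] := cR _ ReB Ren.
have /choice[li hi] := cR _ ImB Imn.
exists [ffun g => (lr g +i* li g)%C] => e e0.
have e4 : 0 < e / 4 by rewrite divr_gt0.
have /choice[nr hnr] := fun g => hr g _ e4.
have /choice[ni hni] := fun g => hi g _ e4.
exists (\max_g maxn (nr g) (ni g))%N => n hn.
rewrite (@le_lt_trans _ _ (e / 4 + e / 4))//; last first.
  by rewrite -mulrDr; lra.
apply: C_hyperoct_norm_le => [|g]; first by rewrite addr_ge0// ltW.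
have /andP[hng1 hng2] : (nr g <= n)%N && (ni g <= n)%N.
  by rewrite -geq_max (leq_trans _ hn)// (leq_bigmax g).
rewrite !ffunE; move: (hnr g _ hng1) (hni g _ hng2).
case: (s n g) => x y hx hy.
rewrite [X in normc X](_ : _ = (x - lr g)%:C%C + (0 +i* (y - li g))%C); last first.
  by apply/eqP; rewrite eq_complex /= addr0 add0r !eqxx.
rewrite (le_trans (le_normcD _ _))// /normc /= !expr0n /= addr0 add0r.
by rewrite !sqrtr_sqr lerD// ltW.
Qed.

HB.instance Definition _ := isCStar.Build R CH
  C_hyperoct_starK C_hyperoct_starD C_hyperoct_starZ C_hyperoct_starM
  C_hyperoct_norm_eq0 C_hyperoct_normD C_hyperoct_normZ C_hyperoct_normM
  C_hyperoct_norm_star C_hyperoct_complete.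

(* The coordinates u_ij : g |-> g_ij. *)
Definition hyperoct_coord : 'M[C_hyperoct R N]_N :=
  \matrix_(i, j) [ffun g => signed_perm_mx R g i j].

End CHyperoct.

(* Main.v *)
Require Import Defs.
From HB Require Import structures.
From mathcomp Require Import all_boot all_order all_algebra all_fingroup.
From mathcomp Require Import complex zify ring lra.
From mathcomp Require Import all_classical all_reals all_analysis.

Set Implicit Arguments.
Unset Strict Implicit.
Unset Printing Implicit Defensive.

Import Order.TTheory GRing.Theory Num.Theory.
Import ComplexField.Normc.

Local Open Scope ring_scope.

(** Points of the 2N-element set are endpoints of N segments; two points are
    equal, opposite, or on different segments, and this relative position is
    the only invariant of a pair under H_N.  More generally, two k-tuples lie in
    the same H_N-orbit exactly when all their pairs have the same relative
    positions (relpos_orbit): a partial injection of segments extends to a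
    permutation, and the signs can then be adjusted.  This gives 1, 3 and 11
    orbits for k = 1, 2, 3: with relative positions recorded along the path
    a, b, c there are 9 possibilities, and the pair (different, different)
    splits into three according to the position of c with respect to a.

    Since the classical generators satisfy the relations of the universal
    algebra, there is a morphism to the functions on H_N, so that every fixed vector
    of the quantum group is fixed by H_N, hence constant on orbits.  The
    substance is the converse: for any solution of the relations, every function
    of the orbit of a triple is fixed.  Two facts suffice.

    - If v x y * v x' y' is nonzero, then (x, x') and (y, y') have the same
      relative position (segment_magic_orthogonal).  So a function of the
      relative positions of consecutive entries takes the same value at i and
      at any j with a nonzero coefficient in row i, and it is fixed because the
      rows of v sum to 1.
    - A fixed vector of the second tensor power, placed on legs 1 and 3, is fixed,
      since the middle leg sums out to 1.

    A function of the orbit of (a, b, c) is the sum of a function of the two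
    consecutive positions and a function of the position of c with respect to a,
    because the latter carries new information only when both consecutive
    positions are different.

    The orthogonality rests on an analytic fact: projections of a C-star-algebra
    with sum 1 are pairwise orthogonal (projections_sum1_orthogonal).  With
    h_k = p_i p_k p_i, the sum of the h_k over k <> i vanishes, so that both
    p_i + t h_j and p_i - t h_j have norm at most 1 for a small t > 0.  In the
    corner of unit e = p_i, a self-adjoint h with e + h and e - h contractive
    must vanish (symmetric_perturbation_eq0).  Indeed e + z h is then
    contractive on the circle |z| = 1/3, thus so are its powers, and the Cauchy
    formula bounds the coefficient M h of z in (e + z h)^M by 3, for arbitrarily
    large M. *)

(** * Elementary estimates in C-star-algebras *)

Lemma normc_real (R : realType) (r : R) : normc r%:C%C = `|r|.
Proof. by rewrite /normc /= expr0n addr0 sqrtr_sqr. Qed.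

(** Discrete Fourier orthogonality for the powers of a root of unity w, which is
    primitive of order 2^(m+1) as its 2^m-th power is not 1. *)
Lemma sum_pow2_root (F : fieldType) (m j : nat) (w : F) :
  (2%:R : F) != 0 -> w ^+ (2 ^ m) = -1 ->
  \sum_(l < 2 ^ m.+1) (w ^+ j) ^+ l = if (2 ^ m.+1 %| j)%N then (2 ^ m.+1)%:R else 0.
Proof.
move=> two_neq0 wm.
have m1_neq1 : -1 != 1 :> F by rewrite -subr_eq0 -opprD oppr_eq0.
have wM : w ^+ (2 ^ m.+1) = 1 by rewrite expnSr exprM wm sqrrN expr1n.
have prim : (2 ^ m.+1).-primitive_root w.
  have [d prim_d d_dvd] := prim_order_exists (expn_gt0 2 m.+1) wM.
  have /(dvdn_pfactor _ _ (isT : prime 2)) [a a_le dE] := d_dvd.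
  have [am | lt_am] := eqVneq a m.+1; first by rewrite -am -dE.
  have : (d %| 2 ^ m)%N by rewrite dE dvdn_exp2l // -ltnS ltn_neqAle lt_am.
  by rewrite (prim_order_dvd prim_d) wm (negPf m1_neq1).
case: ifP => [/dvdnP[q ->]|ndvd].
  rewrite mulnC exprM wM expr1n.
  by under eq_bigr do rewrite expr1n; rewrite sumr_const card_ord.
have wj1 : w ^+ j - 1 != 0.
  by rewrite subr_eq0 -(prim_order_dvd prim) ndvd.
by apply/(mulfI wj1); rewrite -subrX1 exprAC wM expr1n subrr mulr0.
Qed.

Section CStarAlgebraTheory.
Variables (R : realType) (A : cstarAlgType R).
Implicit Types (x y e h p : A) (r : R) (z : R[i]).

Lemma cnorm0 : cnorm (0 : A) = 0.
Proof. by rewrite -(scale0r (0 : A)) cnormZ normc0 mul0r. Qed.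

Lemma cnormZr r x : cnorm (r%:C%C *: x) = `|r| * cnorm x.
Proof. by rewrite cnormZ normc_real. Qed.

Lemma cnorm_ge0 x : 0 <= cnorm x.
Proof.
have := cnormD x ((-1)%:C%C *: x); rewrite cnormZr normrN1 mul1r.
have -> : (-1)%:C%C *: x = - x by rewrite rmorphN1 scaleN1r.
by rewrite subrr cnorm0; lra.
Qed.

Lemma cnorm_sum (I : Type) (s : seq I) (F : I -> A) :
  cnorm (\sum_(i <- s) F i) <= \sum_(i <- s) cnorm (F i).
Proof.
elim/big_ind2: _ => [|x a y b xa yb|//]; first by rewrite cnorm0.
by rewrite (le_trans (cnormD _ _)) ?lerD.
Qed.

Lemma cnorm_contractionM x y : cnorm x <= 1 -> cnorm y <= 1 -> cnorm (x * y) <= 1.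
Proof.
by move=> x1 y1; rewrite (le_trans (cnormM _ _)) // mulr_ile1 ?cnorm_ge0.
Qed.

Lemma cnorm_contractionX x n : cnorm x <= 1 -> cnorm (x ^+ n.+1) <= 1.
Proof.
by move=> x1; elim: n => // n IHn; rewrite exprS cnorm_contractionM.
Qed.

Lemma cnorm_scaled_contraction r x :
  0 <= r -> cnorm x <= 1 -> cnorm (r%:C%C *: x) <= r.
Proof. by move=> r0 x1; rewrite cnormZr ger0_norm // ler_piMr. Qed.

Lemma star1 : star (1 : A) = 1.
Proof. by have := starM (star 1 : A) 1; rewrite mulr1 starK mulr1 => <-. Qed.

Lemma projection1 : projection (1 : A).
Proof. by split; [exact: mulr1 | exact: star1]. Qed.

(** Used in place of arguments on positive elements. *)
Lemma star_mul_eq0 x : star x * x = 0 -> x = 0.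
Proof.
move=> xx0; apply: cnorm_eq0; apply/eqP.
by rewrite -sqrf_eq0 -cnorm_star xx0 cnorm0.
Qed.

Lemma cnorm_projection p : projection p -> cnorm p <= 1.
Proof.
move=> [pp ps]; have := cnorm_star p; rewrite ps pp => pn.
have := cnorm_ge0 p; nra.
Qed.
End CStarAlgebraTheory.

(** * The unit of a corner is a vertex of the unit ball *)

Section Vertex.
Variables (R : realType) (A : cstarAlgType R) (e h : A).
Hypotheses (proj_e : projection e) (sah : star h = h).
Hypotheses (eh : e * h = h) (he : h * e = h).
Hypotheses (ehD : cnorm (e + h) <= 1) (ehB : cnorm (e - h) <= 1).

Let lc (a b c : R[i]) := a *: e + b *: h + c *: (h * h).

Let lcD a b c a' b' c' :
  lc a b c + lc a' b' c' = lc (a + a') (b + b') (c + c').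
Proof. by rewrite /lc !scalerDl addrACA; congr (_ + _); rewrite addrACA. Qed.

Let lcZ d a b c : d *: lc a b c = lc (d * a) (d * b) (d * c).
Proof. by rewrite /lc !scalerDr !scalerA. Qed.

Let mul_lin (z z' : R[i]) :
  (e + z *: h) * (e + z' *: h) = lc 1 (z + z') (z * z').
Proof.
rewrite mulrDl !mulrDr -!scalerAl -!scalerAr eh he proj_e.1 scalerA /lc scale1r.
by rewrite scalerDl !addrA; congr (_ + _); rewrite addrAC.
Qed.

(** By the C-star identity it is enough to bound |e + z h|^2, which is a real
    combination of e, h and h^2, hence a convex combination of contractions
    built from e + h and e - h. *)
Lemma complex_perturbation_contraction (z : R[i]) :
  normc z = 1 -> cnorm (e + ((3^-1)%:C%C * z) *: h) <= 1.
Proof.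
case: z => x y z1.
have xy : x ^+ 2 + y ^+ 2 = 1.
  by rewrite -[LHS]sqr_sqrtr ?addr_ge0 ?sqr_ge0 // [Num.sqrt _]z1 expr1n.
have x1 : -1 <= x <= 1 by apply/andP; split; nra.
have := cnorm_star (e + ((3^-1)%:C%C * (x +i* y)%C) *: h).
rewrite starD starZ sah proj_e.2 mul_lin.
set w := (x +i* y)%C.
(* The square of the modulus is e + (2x/3) h + (1/9) h^2; the h^2 is taken from
   the mean of (e + h)^2 and (e - h)^2, and the four weights, which sum to 1,
   are nonnegative because 1/3 is a small enough radius. *)
have -> :
  lc 1 (((3^-1)%:C%C * w)^*%C + (3^-1)%:C%C * w)
       (((3^-1)%:C%C * w)^*%C * ((3^-1)%:C%C * w)) =
  (18^-1)%:C%C *: ((e + h) * (e + h)) + (18^-1)%:C%C *: ((e - h) * (e - h))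
  + ((4 / 9 + x / 3)%:C%C *: (e + h) + (4 / 9 - x / 3)%:C%C *: (e - h)).
  have e1 : e + h = lc 1 1 0 by rewrite /lc !scale1r scale0r addr0.
  have e2 : e - h = lc 1 (-1) 0 by rewrite /lc scale1r scaleN1r scale0r addr0.
  have := mul_lin 1 1; rewrite !scale1r => ->.
  have := mul_lin (-1) (-1); rewrite !scaleN1r => ->.
  rewrite e1 e2 !lcZ !lcD; congr (lc _ _ _).
  - by apply/eqP; rewrite eq_complex /=; apply/andP; split; apply/eqP; field.
  - by rewrite /w; apply/eqP; rewrite eq_complex /=; apply/andP; split; apply/eqP; field.
  - by rewrite /w; apply/eqP; rewrite eq_complex /=; apply/andP; split; apply/eqP; nra.
move=> cn; rewrite -(@ler_pXn2r _ 2) ?nnegrE ?cnorm_ge0 // -cn expr1n.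
have b1 := cnorm_scaled_contraction (_ : 0 <= 18^-1 :> R) (cnorm_contractionM ehD ehD).
have b2 := cnorm_scaled_contraction (_ : 0 <= 18^-1 :> R) (cnorm_contractionM ehB ehB).
have b3 := cnorm_scaled_contraction (_ : 0 <= 4 / 9 + x / 3) ehD.
have b4 := cnorm_scaled_contraction (_ : 0 <= 4 / 9 - x / 3) ehB.
rewrite (le_trans (cnormD _ _)) // (le_trans (lerD (cnormD _ _) (cnormD _ _))) //.
have := b1 ltac:(lra); have := b2 ltac:(lra).
have := b3 ltac:(lra); have := b4 ltac:(lra); lra.
Qed.

(** Cauchy estimate for the coefficient of z in (e + z h)^M on the circle of
    radius 1/3, the contour integral being the mean over the M-th roots of
    unity.  Taking M to be a power of 2 makes a primitive root available
    from roots of -1. *)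
Lemma pow2_perturbation_bound (m : nat) : (2 ^ m.+1)%:R * cnorm h <= 3.
Proof.
set M := (2 ^ m.+1)%N.
have M_gt1 : (1 < M)%N by rewrite -[1%N](expn0 2) ltn_exp2l.
have M_gt0 : (0 < M)%N by exact: ltnW.
pose w : R[i] := (2 ^ m).-root (-1).
have wm : w ^+ (2 ^ m) = -1 by rewrite rootCK ?expn_gt0.
have normcX (z : R[i]) n : normc (z ^+ n) = normc z ^+ n.
  by elim: n => [|n IHn]; rewrite ?expr0 ?normc1 // !exprS normcM IHn.
have w1 : normc w = 1.
  have /eqP := normcX w (2 ^ m)%N.
  rewrite wm normcN normc1 eq_sym pexprn_eq1 ?normc_ge0 //.
  by rewrite expn_eq0 /= => /eqP.
have two0 : (2 : R[i]) != 0 by rewrite pnatr_eq0.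
pose a : R[i] := (3^-1)%:C%C.
pose f (l : nat) := e + (a * w ^+ l) *: h.
have f1 l : cnorm (f l ^+ M) <= 1.
  rewrite -(prednK M_gt0) cnorm_contractionX //.
  by apply: complex_perturbation_contraction; rewrite normcX w1 expr1n.
have fE l : f l ^+ M = \sum_(k < M.+1)
    (a ^+ k * (w ^+ k) ^+ l) *: (e ^+ (M - k) * h ^+ k *+ 'C(M, k)).
  rewrite /f exprDn_comm; last by rewrite /GRing.comm -scalerAl -scalerAr eh he.
  apply: eq_bigr => k _; rewrite exprZn -scalerAr scalerMnr exprMn.
  by rewrite exprAC.
have eX n : e ^+ n * h = h.
  by elim: n => [|n IHn]; rewrite ?expr0 ?mul1r // exprSr -mulrA eh.
(* The weight w^(l(M-1)) is w^(-l), so that the mean extracts the terms with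
   k = 1 mod M, and k = 1 is the only one up to degree M. *)
have average k x : \sum_(l < M) (w ^+ M.-1) ^+ l *: ((a ^+ k * (w ^+ k) ^+ l) *: x) =
    (a ^+ k * (if (M %| M.-1 + k)%N then M%:R else 0)) *: x.
  rewrite -(sum_pow2_root _ two0 wm) mulr_sumr scaler_suml.
  by apply: eq_bigr => l _; rewrite scalerA mulrCA -exprMn -exprD.
have sumE : \sum_(l < M) (w ^+ M.-1) ^+ l *: f l ^+ M = (M%:R ^+ 2 * a) *: h.
  under eq_bigr => l _ do rewrite fE scaler_sumr.
  rewrite exchange_big /= (bigD1 (Ordinal (leqW M_gt1))) //= average.
  rewrite addn1 prednK // dvdnn big1 => [|k k1].
    rewrite addr0 !expr1 eX bin1 -[h *+ M]scaler_nat scalerA.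
    by congr (_ *: _); ring.
  rewrite average; case: ifP => [|_]; last by rewrite mulr0 scale0r.
  have k_le : (k <= M)%N by rewrite -ltnS.
  have {}k1 : (k != 1 :> nat)%N by [].
  case/dvdnP => -[|[|q]] qE; exfalso; [lia|lia|].
  have : (2 * M <= M.-1 + k)%N by rewrite qE leq_mul2r orbT.
  lia.
have : cnorm ((M%:R ^+ 2 * a) *: h) <= M%:R.
  rewrite -sumE (le_trans (cnorm_sum _ _)) //.
  rewrite -[X in _ <= X%:R]card_ord -sumr_const ler_sum // => l _.
  by rewrite cnormZ !normcX w1 !expr1n mul1r.
have -> : M%:R ^+ 2 * a = (M%:R ^+ 2 / 3)%:C%C.
  by rewrite rmorphM rmorphXn rmorph_nat.
have M0 : 0 < M%:R :> R by rewrite ltr0n.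
rewrite cnormZr ger0_norm ?divr_ge0 ?sqr_ge0 //.
move: (cnorm h) => c; rewrite expr2 -!mulrA -[X in _ <= X]mulr1 ler_pM2l //; lra.
Qed.

(** The Cauchy estimate holds for arbitrarily large M, and R is archimedean. *)
Theorem symmetric_perturbation_eq0 : h = 0.
Proof.
apply: cnorm_eq0; apply/eqP; rewrite eq_le cnorm_ge0 andbT leNgt; apply/negP => c0.
have /ltW c3 : 0 < 3 / cnorm h by rewrite divr_gt0.
have := archi_boundP c3; set m := Num.bound _; rewrite ltr_pdivrMr // => lt3.
have := pow2_perturbation_bound m; apply/negP; rewrite -ltNge.
rewrite (lt_le_trans lt3) // ler_pM2r // ler_nat.
by rewrite (leq_trans (ltnW (ltn_expl m (isT : 1 < 2)%N))) // leq_exp2l.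
Qed.
End Vertex.

(** * Projections with sum 1 *)

Section OrthogonalProjections.
Variables (R : realType) (A : cstarAlgType R) (I : finType) (p : I -> A).
Hypotheses (proj_p : forall i, projection (p i)) (sum_p : \sum_i p i = 1).

(** The compressions h k = p i * p k * p i for k != i sum to 0, while
    p i - 2 h k, the compression of a reflection, is a contraction.  In the
    sum of these contractions over all k other than i and j, the terms - 2 h k
    add up to 2 h j, so that p i can be perturbed in both directions along h j. *)
Theorem projections_sum1_orthogonal i j : i != j -> p j * p i = 0.
Proof.
move=> ij; have [pp ps] := proj_p i.
pose h k := p i * p k * p i.
have sum_h : \sum_(k | k != i) h k = 0.
  have : \sum_k h k = p i.
    by rewrite -mulr_suml -mulr_sumr sum_p mulr1 pp.
  by rewrite (bigD1 i) //= {1}/h !pp -[RHS]addr0 => /addrI.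
have h_sa k : star (h k) = h k by rewrite /h !starM ps (proj_p k).2 mulrA.
have ph k : p i * h k = h k by rewrite /h !mulrA pp.
have hp k : h k * p i = h k by rewrite /h -!mulrA pp.
suff hj : h j = 0.
  apply: star_mul_eq0; rewrite starM ps (proj_p j).2 mulrA -[X in X * _]mulrA.
  by rewrite (proj_p j).1.
have p1 := cnorm_projection (proj_p i).
have refl_contraction k : cnorm (p i - 2%:R *: h k) <= 1.
  have -> : p i - 2%:R *: h k = p i * (1 - 2%:R *: p k) * p i.
    by rewrite mulrBr mulrBl mulr1 pp -scalerAr -scalerAl.
  rewrite !cnorm_contractionM // -(@ler_pXn2r _ 2) ?nnegrE ?cnorm_ge0 //.
  rewrite -cnorm_star expr1n.
  suff -> : star (1 - 2%:R *: p k) * (1 - 2%:R *: p k) = 1.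
    exact/cnorm_projection/projection1.
  have [ppk psk] := proj_p k.
  rewrite starD -scaleNr starZ psk star1 rmorphN rmorph_nat.
  rewrite mulrDl !mulrDr !mul1r !mulr1 -scalerAl -scalerAr ppk scalerA.
  rewrite -addrA -!scalerDl -[RHS]addr0; congr (_ + _).
  by rewrite -[RHS](scale0r (p k)); congr (_ *: _); ring.
pose n := #|[pred k | (k != i) && (k != j)]|.
have sum_others : \sum_(k | (k != i) && (k != j)) (p i - 2%:R *: h k) =
    n%:R *: p i + 2%:R *: h j.
  rewrite sumrB sumr_const -/n -scaler_sumr -scaler_nat -scalerN.
  congr (_ + _ *: _); apply/esym/eqP; rewrite -addr_eq0.
  by rewrite -(bigD1 j) ?sum_h // eq_sym.
have others_le : cnorm (n%:R *: p i + 2%:R *: h j) <= n%:R.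
  rewrite -sum_others /n -sumr_const.
  elim/big_ind2: _ => [|x b y c xb yc|k _]; rewrite ?cnorm0 //.
  by rewrite (le_trans (cnormD _ _)) ?lerD.
have n0 : 0 <= n.+1%:R^-1 :> R by rewrite invr_ge0.
have n1C : (n.+1%:R : R[i]) != 0 by rewrite pnatr_eq0.
pose c : R[i] := (n.+1%:R^-1)%:C%C.
have cE : c = n.+1%:R^-1 by rewrite /c rmorphV ?unitfE // rmorph_nat.
(* Dividing by n + 1 rather than n allows n = 0, and the extra copy of p i keeps
   both perturbations convex combinations of contractions. *)
pose H := (c * 2) *: h j.
have avg_contraction x : cnorm x <= n%:R + 1 -> cnorm (c *: x) <= 1.
  move=> xn; rewrite cnormZr ger0_norm // mulrC ler_pdivrMr ?ltr0n // mul1r.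
  by rewrite -natr1.
suff /eqP : H = 0.
  rewrite scaler_eq0 cE mulf_eq0 invr_eq0 (negPf n1C) pnatr_eq0 /=.
  by move/eqP.
apply: (symmetric_perturbation_eq0 (proj_p i)).
- by rewrite /H starZ h_sa rmorphM rmorph_nat; congr (_ * _ *: _); exact: conjc_real.
- by rewrite -scalerAr ph.
- by rewrite -scalerAl hp.
- have -> : p i + H = c *: (n%:R *: p i + 2%:R *: h j + p i).
    rewrite addrAC scalerDr !scalerA; congr (_ + _).
    by rewrite -[X in _ *: (_ + X)]scale1r -scalerDl natr1 scalerA cE mulVf ?scale1r.
  by apply: avg_contraction; rewrite (le_trans (cnormD _ _)) ?lerD.
- have -> : p i - H = c *: (n%:R *: p i + (p i - 2%:R *: h j)).
    rewrite addrA scalerBr scalerA; congr (_ - _).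
    by rewrite -[X in _ *: (_ + X)]scale1r -scalerDl natr1 scalerA cE mulVf ?scale1r.
  apply: avg_contraction; rewrite (le_trans (cnormD _ _)) ?lerD //.
  by have := cnorm_scaled_contraction (ler0n R n) p1; rewrite rmorph_nat.
Qed.
End OrthogonalProjections.

(** * Relative position of two endpoints *)

Section Points.
Variable N : nat.
Implicit Types (x y z : 'I_(N + N)) (s : 'I_N) (b : bool).

Definition segment x : 'I_N := match fintype.split x with inl s | inr s => s end.
Definition side x : bool := if fintype.split x is inr _ then true else false.
Definition endpoint s b : 'I_(N + N) := if b then rshift N s else lshift N s.

Lemma segmentK s b : segment (endpoint s b) = s.
Proof. by case: b; rewrite /segment /endpoint (unsplitK (inl s), unsplitK (inr s)). Qed.

Lemma sideK s b : side (endpoint s b) = b.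
Proof. by case: b; rewrite /side /endpoint (unsplitK (inl s), unsplitK (inr s)). Qed.

Lemma endpointK x : endpoint (segment x) (side x) = x.
Proof. by rewrite -[RHS]splitK /segment /side; case: (fintype.split x). Qed.

(** A complete invariant of the H_N-orbit of (x, y): equal, opposite, or on
    different segments. *)
Definition relpos x y : option bool :=
  if segment x == segment y then Some (side x (+) side y) else None.

Lemma relposC x y : relpos x y = relpos y x.
Proof. by rewrite /relpos eq_sym addbC. Qed.

Lemma relposxx x : relpos x x = Some false.
Proof. by rewrite /relpos eqxx addbb. Qed.

Definition compose_relpos (r r' : option bool) : option bool :=
  if r is Some b then (if r' is Some b' then Some (b (+) b') else None) else None.

(** Once one of the two steps stays within a segment, the position of the last
    point is determined by the two steps. *)
Lemma relpos_compose x y z : (relpos x y != None) || (relpos y z != None) ->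
  relpos x z = compose_relpos (relpos x y) (relpos y z).
Proof.
rewrite /relpos; have [->|xy] := eqVneq (segment x) (segment y).
  case: ifP => //= _ _; congr Some.
  by case: (side x); case: (side y); case: (side z).
by have [<-|//] := eqVneq (segment y) (segment z); rewrite (negPf xy).
Qed.

Lemma relpos_endpoint (s t : 'I_N) b b' :
  relpos (endpoint s b) (endpoint t b') = if s == t then Some (b (+) b') else None.
Proof. by rewrite /relpos !segmentK !sideK. Qed.

End Points.

(** * Tensor powers of a matrix with row sums 1 *)

Lemma sum_tuple_cons (V : nmodType) (T : finType) k (F : k.+1.-tuple T -> V) :
  \sum_j F j = \sum_a \sum_(t : k.-tuple T) F [tuple of a :: t].
Proof.
rewrite pair_bigA (reindex (fun at_ : T * k.-tuple T => [tuple of at_.1 :: at_.2])) //=.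
exists (fun j : k.+1.-tuple T => (thead j, [tuple of behead j])) => [[a t] _|j _] /=.
  by rewrite theadE; congr pair; apply: val_inj.
by rewrite -tuple_eta.
Qed.

Lemma sum_tuple0 (V : nmodType) (T : finType) (F : 0.-tuple T -> V) :
  \sum_j F j = F [tuple].
Proof.
rewrite (bigD1 [tuple]) //= big1 ?addr0 // => j /eqP[]; exact: tuple0.
Qed.

Lemma tuple2_ex (T : Type) (i : 2.-tuple T) : exists a b, i = [tuple a; b].
Proof.
case/tupleP: i => a i; case/tupleP: i => b i.
by exists a, b; apply: val_inj; rewrite /= tuple0.
Qed.

Lemma tuple3_ex (T : Type) (i : 3.-tuple T) :
  exists a b c, i = [tuple a; b; c].
Proof.
case/tupleP: i => a i; case/tupleP: i => b i; case/tupleP: i => c i.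
by exists a, b, c; apply: val_inj; rewrite /= tuple0.
Qed.

Lemma sum_tuple3 (V : nmodType) (T : finType) (F : 3.-tuple T -> V) :
  \sum_j F j = \sum_a \sum_b \sum_c F [tuple a; b; c].
Proof.
rewrite sum_tuple_cons; apply: eq_bigr => a _.
rewrite sum_tuple_cons; apply: eq_bigr => b _.
rewrite sum_tuple_cons; apply: eq_bigr => c _.
by rewrite sum_tuple0; congr F; apply: val_inj.
Qed.

Lemma sum_tuple2 (V : nmodType) (T : finType) (F : 2.-tuple T -> V) :
  \sum_j F j = \sum_a \sum_b F [tuple a; b].
Proof.
rewrite sum_tuple_cons; apply: eq_bigr => a _.
rewrite sum_tuple_cons; apply: eq_bigr => b _.
by rewrite sum_tuple0; congr F; apply: val_inj.
Qed.

Section TensorPowers.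
Variables (R : realType) (A : cstarAlgType R) (M : nat).
Implicit Types v : 'M[A]_M.

Lemma tensor_power0 v (i j : 0.-tuple 'I_M) : tensor_power v i j = 1.
Proof. by rewrite /tensor_power big_ord0. Qed.

Lemma tensor_power_cons v k a b (i j : k.-tuple 'I_M) :
  tensor_power v [tuple of a :: i] [tuple of b :: j] = v a b * tensor_power v i j.
Proof.
rewrite /tensor_power big_ord_recl !tnth0; congr (_ * _).
by apply: eq_bigr => l _; rewrite !tnthS.
Qed.

Lemma tensor_power_row_sum v k (i : k.-tuple 'I_M) :
  (forall x, \sum_y v x y = 1) -> \sum_j tensor_power v i j = 1.
Proof.
move=> row_sum; elim: k i => [|k IHk] i; first by rewrite sum_tuple0 tensor_power0.
case/tupleP: i => a i; rewrite sum_tuple_cons -(row_sum a); apply: eq_bigr => b _.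
under eq_bigr do rewrite tensor_power_cons.
by rewrite -mulr_sumr IHk mulr1.
Qed.

(** As the entries of row i of the tensor power sum to 1, the fixed vector equation
    at i holds as soon as xi j = xi i for every j that contributes. *)
Lemma fixed_vector_support v k (xi : {ffun k.-tuple 'I_M -> R[i]^o}) :
  (forall x, \sum_y v x y = 1) ->
  (forall i j, tensor_power v i j != 0 -> xi j = xi i) -> fixed_vector v xi.
Proof.
move=> row_sum supp i.
rewrite -(tensor_power_row_sum i row_sum) scaler_sumr; apply: eq_bigr => j _.
by have [->|/supp->//] := eqVneq (tensor_power v i j) 0; rewrite !scaler0.
Qed.

Lemma tensor_power2 v a b a' b' :
  tensor_power v [tuple a; b] [tuple a'; b'] = v a a' * v b b'.
Proof. by rewrite /tensor_power !big_ord_recl big_ord0 mulr1. Qed.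

Lemma tensor_power3 v a b c a' b' c' :
  tensor_power v [tuple a; b; c] [tuple a'; b'; c'] = v a a' * v b b' * v c c'.
Proof. by rewrite /tensor_power !big_ord_recl big_ord0 mulr1 mulrA. Qed.

(** The sum over the free middle leg gives 1; this is how nonadjacent entries can
    be compared even though the corresponding entries of v do not commute. *)
Lemma fixed_vector_insert_middle v (eta : {ffun 2.-tuple 'I_M -> R[i]^o})
    (xi : {ffun 3.-tuple 'I_M -> R[i]^o}) :
  (forall x, \sum_y v x y = 1) -> fixed_vector v eta ->
  (forall a b c, xi [tuple a; b; c] = eta [tuple a; c]) -> fixed_vector v xi.
Proof.
move=> row_sum fix_eta xiE i; have [a [b [c ->]]] := tuple3_ex i.
rewrite xiE -fix_eta sum_tuple3 sum_tuple2; apply: eq_bigr => a' _.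
rewrite exchange_big /=; apply: eq_bigr => c' _.
under eq_bigr => b' _ do rewrite tensor_power3 xiE.
by rewrite -scaler_sumr -mulr_suml -mulr_sumr row_sum mulr1 tensor_power2.
Qed.
End TensorPowers.

(** * The magic unitary of the segments *)

Section SegmentMagic.
Variables (R : realType) (A : cstarAlgType R) (N : nat) (u : 'M[A]_N).
Implicit Types (s t : 'I_N) (x y : 'I_(N + N)).
Local Notation v := (segment_magic u).
Local Notation p s t := (u s t ^+ 2).

(** In the even and odd functions on each segment, v splits into the matrix of
    squares p and the matrix u. *)
Lemma segment_magicE x y : v x y =
  (2^-1 : R[i]) *: (p (segment x) (segment y) +
    (-1) ^+ (side x (+) side y) *: u (segment x) (segment y)).
Proof.
rewrite -{1}[x]endpointK -{1}[y]endpointK /segment_magic /endpoint.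
by case: (side x); case: (side y);
  rewrite ?(block_mxEul, block_mxEur, block_mxEdl, block_mxEdr) !mxE
    /= ?expr0 ?expr1 ?scale1r ?scaleN1r.
Qed.

Hypothesis hu : hyperoct_relations u.

Let projp s t : projection (p s t).
Proof. by have [_ _ _ [/(_ s t)]] := hu; rewrite mxE. Qed.

Let row_sum s : \sum_t p s t = 1.
Proof.
by have [_ _ _ [_ /(_ s) <- _]] := hu; apply: eq_bigr => t _; rewrite mxE.
Qed.

Let col_sum t : \sum_s p s t = 1.
Proof.
by have [_ _ _ [_ _ /(_ t) <-]] := hu; apply: eq_bigr => s _; rewrite mxE.
Qed.

(** The squares are idempotent, so the self-adjoint u^3 - u has square
    u^6 - 2 u^4 + u^2 = 0. *)
Lemma hyperoct_cubic s t : u s t ^+ 3 = u s t.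
Proof.
have sa : star (u s t) = u s t by have [] := hu.
have [pp _] := projp s t.
have p2 : u s t ^+ 4 = u s t ^+ 2 by rewrite -[RHS]pp -exprD.
have star3 : star (u s t ^+ 3) = u s t ^+ 3.
  by rewrite !exprS expr0 mulr1 !starM sa mulrA.
apply/eqP; rewrite -subr_eq0; apply/eqP/star_mul_eq0.
rewrite starD -scaleN1r starZ star3 sa rmorphN1 scaleN1r.
rewrite mulrBl !mulrBr -!exprS -!exprSr -exprD.
by rewrite (exprD _ 4 2) p2 -exprD p2 !subrr.
Qed.

Let up s t : u s t * p s t = u s t. Proof. by rewrite -exprS hyperoct_cubic. Qed.
Let pu s t : p s t * u s t = u s t. Proof. by rewrite -exprSr hyperoct_cubic. Qed.

(** Since u = u p = p u, the orthogonality of the squares passes to u itself. *)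
Lemma hyperoct_row_orthogonal s t t' : t != t' -> u s t * u s t' = 0.
Proof.
rewrite eq_sym => /(projections_sum1_orthogonal (projp s) (row_sum s)) /= pp0.
by rewrite -up -[X in _ * X]pu -mulrA [X in _ * X]mulrA pp0 mul0r mulr0.
Qed.

Lemma hyperoct_col_orthogonal t s s' : s != s' -> u s t * u s' t = 0.
Proof.
rewrite eq_sym.
move=> /(projections_sum1_orthogonal (fun i => projp i t) (col_sum t)) /= pp0.
by rewrite -up -[X in _ * X]pu -mulrA [X in _ * X]mulrA pp0 mul0r mulr0.
Qed.

Lemma segment_magic_row_sum x : \sum_y v x y = 1.
Proof.
rewrite big_split_ord /= -big_split /= -(row_sum (segment x)).
apply: eq_bigr => t _; rewrite !segment_magicE.
rewrite (segmentK t false : segment (lshift N t) = t).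
rewrite (segmentK t true : segment (rshift N t) = t).
rewrite (sideK t false : side (lshift N t) = false).
rewrite (sideK t true : side (rshift N t) = true).
rewrite -scalerDr addrACA -scalerDl.
have -> : (-1) ^+ (side x (+) false) + (-1) ^+ (side x (+) true) = 0 :> R[i].
  by case: (side x); rewrite /= ?expr0 ?expr1 ?subrr ?addNr.
  rewrite scale0r addr0 -mulr2n -[X in _ *: X]scaler_nat scalerA mulVf ?pnatr_eq0 //.
  by rewrite scale1r.
Qed.

(** If one pair shares a segment and the other does not, the two factors involve
    distinct entries of the same row or column of u.  If both pairs share a
    segment, but with different relative sides, the factors are a multiple of
    p + e u and p - e u with e^2 = 1, whose product is p^2 - u^2 = 0. *)
Lemma segment_magic_orthogonal x x' y y' :
  relpos x x' != relpos y y' -> v x y * v x' y' = 0.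
Proof.
have disjoint s t s' t' (e e' : R[i]) : u s t * u s' t' = 0 ->
    (p s t + e *: u s t) * (p s' t' + e' *: u s' t') = 0.
  move=> uu0.
  have -> : p s t + e *: u s t = (u s t + e%:A) * u s t.
    by rewrite mulrDl -expr2 -scalerAl mul1r.
  have -> : p s' t' + e' *: u s' t' = u s' t' * (u s' t' + e'%:A).
    by rewrite mulrDr -expr2 -scalerAr mulr1.
  by rewrite -mulrA [X in _ * X]mulrA uu0 mul0r mulr0.
rewrite /relpos !segment_magicE -scalerAl -scalerAr.
have [xx'|xx'] := eqVneq (segment x) (segment x');
    have [yy'|yy'] := eqVneq (segment y) (segment y') => // sides.
- have sides_ne : side x' (+) side y' = ~~ (side x (+) side y).
    by move: sides; case: (side x); case: (side x'); case: (side y); case: (side y').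
  rewrite xx' yy' sides_ne; move: (_ (+) _) => b; set e := (-1) ^+ b.
  have -> : (-1) ^+ (~~ b) = - e by rewrite signrN.
  rewrite mulrDl !mulrDr -!scalerAl -!scalerAr up pu (projp _ _).1.
  rewrite (scalerA e) mulrN -[e * e]expr2 sqrr_sign scaleN1r expr2 scaleNr.
  by rewrite addrA -[_ - _ + _]addrA addNr addr0 subrr !scaler0.
- by rewrite disjoint ?scaler0 // xx' hyperoct_row_orthogonal.
- by rewrite disjoint ?scaler0 // yy' hyperoct_col_orthogonal.
Qed.

Lemma fixed_vector1 (g : R[i]) (xi : {ffun 1.-tuple 'I_(N + N) -> R[i]^o}) :
  (forall j, xi j = g) -> fixed_vector v xi.
Proof.
move=> xiE; apply: fixed_vector_support => [|i j _]; last by rewrite !xiE.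
exact: segment_magic_row_sum.
Qed.

Lemma fixed_vector2 (g : option bool -> R[i])
    (xi : {ffun 2.-tuple 'I_(N + N) -> R[i]^o}) :
  (forall a b, xi [tuple a; b] = g (relpos a b)) -> fixed_vector v xi.
Proof.
move=> xiE; apply: fixed_vector_support => [|i j]; first exact: segment_magic_row_sum.
have [a [b ->]] := tuple2_ex i; have [a' [b' ->]] := tuple2_ex j.
rewrite tensor_power2 !xiE; apply: contraNeq => ne.
by apply/eqP/segment_magic_orthogonal; apply: contraNneq ne => ->.
Qed.

Lemma fixed_vector3_adjacent (g : option bool -> option bool -> R[i])
    (xi : {ffun 3.-tuple 'I_(N + N) -> R[i]^o}) :
  (forall a b c, xi [tuple a; b; c] = g (relpos a b) (relpos b c)) ->
  fixed_vector v xi.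
Proof.
move=> xiE; apply: fixed_vector_support => [|i j]; first exact: segment_magic_row_sum.
have [a [b [c ->]]] := tuple3_ex i; have [a' [b' [c' ->]]] := tuple3_ex j.
rewrite tensor_power3 !xiE; apply: contraNeq => ne.
have [ab|ab] := eqVneq (relpos a b) (relpos a' b').
  rewrite -mulrA segment_magic_orthogonal ?mulr0 //.
  by apply: contraNneq ne => ->; rewrite ab.
by rewrite segment_magic_orthogonal ?mul0r.
Qed.

End SegmentMagic.

(** * The orbit of a short tuple *)

Section Types.
Variable N : nat.

Definition orbit_type1 (i : 1.-tuple 'I_(N + N)) : unit := tt.

Definition orbit_type2 (i : 2.-tuple 'I_(N + N)) : option bool :=
  relpos (tnth i ord0) (tnth i ord_max).

(** The position of the last entry with respect to the first is recorded only
    when the consecutive positions leave it open, and there only if the two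
    entries share a segment; the case of three different segments is kept in
    the left summand, which makes the cardinal 3 * 3 + 2 = 11. *)
Definition orbit_type3 (i : 3.-tuple 'I_(N + N)) : option bool * option bool + bool :=
  let a := tnth i ord0 in let b := tnth i (lift ord0 ord0) in
  let c := tnth i ord_max in
  if (relpos a b, relpos b c, relpos a c) is (None, None, Some s) then inr s
  else inl (relpos a b, relpos b c).

Lemma orbit_type2E (a b : 'I_(N + N)) : orbit_type2 [tuple a; b] = relpos a b.
Proof. by []. Qed.

Lemma orbit_type3E (a b c : 'I_(N + N)) : orbit_type3 [tuple a; b; c] =
  if (relpos a b, relpos b c, relpos a c) is (None, None, Some s) then inr s
  else inl (relpos a b, relpos b c).
Proof. by []. Qed.

(** The left inverse of the encoding: the orbit type determines all the relative
    positions. *)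
Definition relpos_of_orbit_type3 (t : option bool * option bool + bool) :=
  match t with
  | inl (r, r') => (r, r', compose_relpos r r')
  | inr s => (None, None, Some s)
  end.

Lemma orbit_type3K (a b c : 'I_(N + N)) :
  relpos_of_orbit_type3 (orbit_type3 [tuple a; b; c]) = (relpos a b, relpos b c, relpos a c).
Proof.
rewrite orbit_type3E; have := @relpos_compose N a b c.
case: (relpos a b) => [x|]; case: (relpos b c) => [y|] /=; last by case: (relpos a c).
all: by move=> ->.
Qed.

End Types.

(** * Functions of the orbit are fixed *)

Section FixedByType.
Variables (R : realType) (A : cstarAlgType R) (N : nat) (u : 'M[A]_N).
Hypothesis hu : hyperoct_relations u.
(** Write xi as far + near, where far depends on the relative position of the
    outer entries and near on the consecutive ones.  The function d measures by
    how much g changes when the outer entries come to share a segment while the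
    middle one lies elsewhere; the correction c removes the contribution of d from
    the configurations in which the consecutive positions already determine the
    outer one. *)
Lemma fixed_vector3 (g : (option bool * option bool) + bool -> R[i])
    (xi : {ffun 3.-tuple 'I_(N + N) -> R[i]^o}) :
  (forall i, xi i = g (orbit_type3 i)) -> fixed_vector (segment_magic u) xi.
Proof.
move=> xiE; pose d r := if r is Some s then g (inr s) - g (inl (None, None)) else 0.
pose c r r' := if (r != None) || (r' != None) then d (compose_relpos r r') else 0.
pose far : {ffun 3.-tuple 'I_(N + N) -> R[i]^o} :=
  [ffun i => d (relpos (tnth i ord0) (tnth i ord_max))].
have -> : xi = 1 *: far + (xi - far) by rewrite scale1r addrC subrK.
apply: fixed_vectorP.
  pose eta : {ffun 2.-tuple 'I_(N + N) -> R[i]^o} :=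
    [ffun i => d (relpos (tnth i ord0) (tnth i ord_max))].
  apply: (@fixed_vector_insert_middle _ _ _ _ eta).
  - exact: segment_magic_row_sum.
  - by apply: (fixed_vector2 hu (g := d)) => x y; rewrite ffunE.
  - by move=> x y z; rewrite !ffunE.
apply: (fixed_vector3_adjacent hu (g := fun r r' => g (inl (r, r')) - c r r')).
move=> x y z; rewrite !ffunE xiE /orbit_type3 /c.
have -> : tnth [tuple x; y; z] ord0 = x by [].
have -> : tnth [tuple x; y; z] (lift ord0 ord0) = y by [].
have -> : tnth [tuple x; y; z] ord_max = z by [].
case: ifP => [xyz|].
  rewrite -(relpos_compose xyz); move: xyz.
  by case: (relpos x y) => [?|]; case: (relpos y z) => [?|].
case: (relpos x y) => //; case: (relpos y z) => // _.
by case: (relpos x z) => [s|] /=; ring.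
Qed.
End FixedByType.

(** * Comparison with the group of signed permutations *)

Section Transport.
Variables (R : realType) (A B : cstarAlgType R) (N : nat).
Variables (u : 'M[A]_N) (w : 'M[B]_N) (f : {lrmorphism A -> B}).
Hypothesis fu : forall i j, f (u i j) = w i j.

Lemma fixed_vector_morphism k (xi : {ffun k.-tuple 'I_(N + N) -> R[i]^o}) :
  fixed_vector (segment_magic u) xi -> fixed_vector (segment_magic w) xi.
Proof.
move=> fix_u i.
have fv x y : f (segment_magic u x y) = segment_magic w x y.
  by rewrite !segment_magicE -fu linearZ linearD linearZ rmorphXn.
have := congr1 f (fix_u i); rewrite linear_sum linearZ rmorph1 => <-.
apply: eq_bigr => j _; rewrite linearZ rmorph_prod; congr (_ *: _).
by apply: eq_bigr => l _; exact/esym/fv.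
Qed.
End Transport.

Section ClassicalOrbits.
Variable N : nat.
Implicit Types (g : hyperoct N) (x y : 'I_(N + N)).

Definition signed_act g x : 'I_(N + N) :=
  endpoint (g.1 (segment x)) (g.2 (segment x) (+) side x).

(** Induction on s: if the value f l is new, the permutation found so far is
    composed with the transposition that moves its value there to h l; it does
    not disturb the earlier values because these are different from both. *)
Lemma exists_perm_extension (I : eqType) (T : finType) (f h : I -> T) (s : seq I) :
  {in s &, forall l m, (f l == f m) = (h l == h m)} ->
  exists q : {perm T}, {in s, forall l, q (f l) = h l}.
Proof.
elim: s => [|l s IHs] fh; first by exists 1%g.
have [|q qE] := IHs.
  by move=> m n ms ns; apply: fh; rewrite in_cons (ms, ns) orbT.
have [/hasP[m ms /eqP fm]|/hasPn fresh] := boolP (has (fun m => f m == f l) s).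
  exists q => n; rewrite in_cons => /predU1P[->|/qE//].
  by rewrite -fm qE //; apply/eqP; rewrite -fh ?fm ?in_cons ?eqxx ?ms ?orbT.
exists (q * tperm (q (f l)) (h l))%g => n; rewrite in_cons permM.
case/predU1P => [->|ns]; first by rewrite tpermL.
rewrite -(qE n ns) tpermD // ?(inj_eq perm_inj) 1?eq_sym ?fresh //.
by rewrite qE // -fh ?in_cons ?eqxx ?ns ?orbT // fresh.
Qed.

(** The relative positions say which entries share a segment, hence the segments
    can be permuted into place; on each segment they also say that all the
    entries must change sides together, which defines the signs. *)
Lemma relpos_orbit k (i j : k.-tuple 'I_(N + N)) :
  (forall l m, relpos (tnth i l) (tnth i m) = relpos (tnth j l) (tnth j m)) ->
  exists g, forall l, signed_act g (tnth i l) = tnth j l.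
Proof.
move=> ij.
have [|q qE] := @exists_perm_extension 'I_k 'I_N (@segment N \o tnth i)
    (@segment N \o tnth j) (enum 'I_k).
  move=> l m _ _ /=; have := ij l m; rewrite /relpos.
  by case: ifP; case: ifP.
pose flip s : bool := [exists l, (segment (tnth i l) == s) &&
  (side (tnth i l) != side (tnth j l))].
exists (q, [ffun s => flip s]) => l; rewrite /signed_act /= ffunE.
rewrite [q _](qE l (mem_enum _ l)) /= -[RHS]endpointK; congr endpoint.
suff -> : flip (segment (tnth i l)) = side (tnth i l) (+) side (tnth j l).
  by rewrite addbAC addbb.
apply/existsP/idP => [[m /andP[/eqP same ne]]|ne]; last first.
  by exists l; rewrite eqxx; move: ne; case: (side _); case: (side _).
have := ij m l; rewrite /relpos same eqxx.
case: ifP => // _ []; move: ne.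
by case: (side (tnth i m)); case: (side (tnth j m)); case: (side (tnth i l));
   case: (side (tnth j l)).
Qed.

End ClassicalOrbits.

Section Classical.
Variables (R : realType) (N : nat).
Local Notation C := (C_hyperoct R N).
Local Notation coord := (hyperoct_coord R N).
Implicit Types (g : hyperoct N).

Lemma hyperoct_coordE s t g :
  coord s t g = (-1) ^+ g.2 s *+ (g.1 s == t) :> R[i].
Proof. by rewrite !mxE ffunE mxE. Qed.

Lemma C_hyperoct_sumE (I : Type) (r : seq I) (F : I -> C) g :
  ((\sum_(i <- r) F i) g = \sum_(i <- r) F i g :> R[i]).
Proof. by apply: (big_morph (fun f : C => f g : R[i])) => [x y|]; rewrite ffunE. Qed.

Lemma C_hyperoct_prodE (I : Type) (r : seq I) (F : I -> C) g :
  ((\prod_(i <- r) F i) g = \prod_(i <- r) F i g :> R[i]).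
Proof. by apply: (big_morph (fun f : C => f g : R[i])) => [x y|]; rewrite ffunE. Qed.

Lemma hyperoct_coord_sqrE s t g : (coord s t ^+ 2) g = (g.1 s == t)%:R :> R[i].
Proof.
rewrite expr2 ffunE hyperoct_coordE -expr2; case: eqP => _.
  by rewrite mulr1n sqrr_sign.
by rewrite mulr0n expr0n.
Qed.

Lemma hyperoct_coord_relations : hyperoct_relations coord.
Proof.
split.
- move=> s t; apply/ffunP => g; rewrite ffunE hyperoct_coordE.
  by rewrite rmorphMn rmorph_sign.
- apply/matrixP => s t; rewrite !mxE; apply/ffunP => g.
  rewrite C_hyperoct_sumE (bigD1 (g.1 s)) //= big1 => [|x sx].
    rewrite addr0 ffunE [_^T _ _]mxE !hyperoct_coordE eqxx mulr1n (inj_eq perm_inj) eq_sym.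
    case: eqVneq => [->|_]; last by rewrite mulr0n mulr0 ffunE.
    by rewrite mulr1n -expr2 sqrr_sign ffunE.
  by rewrite ffunE hyperoct_coordE eq_sym (negPf sx) mul0r.
- apply/matrixP => s t; rewrite !mxE; apply/ffunP => g.
  rewrite C_hyperoct_sumE (bigD1 ((g.1)^-1%g s)) //= big1 => [|x sx].
    rewrite addr0 ffunE [_^T _ _]mxE !hyperoct_coordE permKV eqxx mulr1n.
    case: eqVneq => [->|_]; last by rewrite mulr0n mulr0 ffunE.
    by rewrite mulr1n -expr2 sqrr_sign ffunE.
  rewrite ffunE [_^T _ _]mxE hyperoct_coordE (_ : (g.1 x == s) = false) ?mul0r //.
  by apply: contraNF sx => /eqP <-; rewrite permK.
- split=> [s t|s|t]; first split.
  + apply/ffunP => g; rewrite mxE ffunE hyperoct_coord_sqrE.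
    by case: eqP; rewrite ?mulr0 ?mulr1.
  + by apply/ffunP => g; rewrite mxE ffunE hyperoct_coord_sqrE rmorph_nat.
  + apply/ffunP => g; rewrite C_hyperoct_sumE ffunE.
    under eq_bigr do rewrite mxE hyperoct_coord_sqrE.
    by rewrite (bigD1 (g.1 s)) //= eqxx big1 ?addr0 // => t /negPf; rewrite eq_sym => ->.
  + apply/ffunP => g; rewrite C_hyperoct_sumE ffunE.
    under eq_bigr do rewrite mxE hyperoct_coord_sqrE.
    rewrite (bigD1 ((g.1)^-1%g t)) //= permKV eqxx big1 ?addr0 // => s st.
    by rewrite (_ : (g.1 s == t) = false) //; apply: contraNF st => /eqP <-; rewrite permK.
Qed.

(** Evaluated at a group element, v is a permutation matrix: the action on the
    endpoints. *)
Lemma segment_magic_coordE x y g :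
  segment_magic coord x y g = (signed_act g x == y)%:R :> R[i].
Proof.
have -> : (signed_act g x == y) =
    (g.1 (segment x) == segment y) && (g.2 (segment x) (+) side x == side y).
  apply/eqP/andP => [<-|[/eqP sxy /eqP bxy]].
    by rewrite /signed_act segmentK sideK !eqxx.
  by rewrite /signed_act sxy bxy endpointK.
have scaleE a (f : C) : (a *: f) g = a * f g :> R[i] by rewrite ffunE.
have addE (f h : C) : (f + h) g = f g + h g :> R[i] by rewrite ffunE.
rewrite segment_magicE scaleE addE scaleE hyperoct_coord_sqrE hyperoct_coordE.
case: eqP => _ /=; last by rewrite mulr0n mulr0 addr0 mulr0.
have half : (2^-1 * (1 + 1) : R[i]) = 1 by rewrite -[1 + 1]/(2%:R) mulVf ?pnatr_eq0.
rewrite mulr1n -signr_addb.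
by case: (side x); case: (side y); case: (g.2 _);
  rewrite /= ?expr0 ?expr1 ?half ?subrr ?mulr0.
Qed.

Lemma classical_fixed_invariant k (xi : {ffun k.-tuple 'I_(N + N) -> R[i]^o}) :
  fixed_vector (segment_magic coord) xi ->
  forall g (i j : k.-tuple 'I_(N + N)),
    (forall l, signed_act g (tnth i l) = tnth j l) -> xi i = xi j.
Proof.
move=> fix_xi g i j ij; have := congr1 (fun f : C => f g : R[i]) (fix_xi i).
have tpE t : tensor_power (segment_magic coord) i t g = (j == t)%:R :> R[i].
  rewrite C_hyperoct_prodE; under eq_bigr do rewrite segment_magic_coordE ij.
  have [<-|jt] := eqVneq j t; first by rewrite big1 // => l _; rewrite eqxx.
  have [l jtl] : exists l, tnth j l != tnth t l.
    by apply/existsP; apply: contraNT jt; rewrite negb_exists => /forallP jt;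
       apply/eqP/eq_from_tnth => l; apply/eqP; rewrite -[_ == _]negbK.
  by rewrite (bigD1 l) //= (negPf jtl) mul0r.
rewrite C_hyperoct_sumE (bigD1 j) //= big1 ?addr0 => [|t /negPf jt].
  by rewrite !ffunE tpE eqxx /GRing.scale /= !mulr1 => ->.
by rewrite ffunE tpE eq_sym jt scaler0.
Qed.
End Classical.

(** * Counting orbitals *)

Lemma dim_pullback (K : fieldType) (I T : finType) (f : I -> T)
    (F : {vspace {ffun I -> K^o}}) :
  (forall t, exists i, f i = t) ->
  (forall xi, xi \in F <-> exists g : T -> K, forall i, xi i = g (f i)) ->
  \dim F = #|T|.
Proof.
move=> surj FP.
pose pull (g : {ffun T -> K^o}) : {ffun I -> K^o} := [ffun i => g (f i)].
have pull_linear : linear pull by move=> a g h; apply/ffunP => i; rewrite !ffunE.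
pose pullL := GRing.isLinear.Build K _ _ _ pull pull_linear.
pose L : {linear {ffun T -> K^o} -> {ffun I -> K^o}} := HB.pack pull pullL.
have -> : F = limg (linfun L).
  apply/vspaceP => xi; apply/idP/memv_imgP => [/FP[g xiE]|[g _ ->]].
    exists [ffun t => g t]; first exact: memvf.
    by rewrite lfunE; apply/ffunP => i; rewrite /= !ffunE xiE.
  by apply/FP; exists g => i; rewrite lfunE /= ffunE.
rewrite limg_dim_eq; first by rewrite dimvf /dim /= muln1.
apply/eqP; rewrite -subv0; apply/subvP => g; rewrite memv_cap memv_ker lfunE /=.
move=> /andP[_ /eqP g0]; rewrite memv0; apply/eqP/ffunP => t.
by have [i <-] := surj t; have := congr1 (fun h : {ffun I -> K^o} => h i) g0; rewrite !ffunE.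
Qed.

Section NumOrbitals.
Variables (R : realType) (N : nat) (A : cstarAlgType R) (u : 'M[A]_N).
Hypothesis hu : is_C_free_hyperoct u.
Local Notation coord := (hyperoct_coord R N).

Lemma free_fixed_classical k (xi : {ffun k.-tuple 'I_(N + N) -> R[i]^o}) :
  fixed_vector (segment_magic u) xi -> fixed_vector (segment_magic coord) xi.
Proof.
have [f [_ fu _]] := hu.2 _ _ (hyperoct_coord_relations R N).
exact: (fixed_vector_morphism fu).
Qed.

(** A classification of k-tuples by a finite type yields the number of orbitals of
    both quantum groups if functions of the type are fixed whenever the defining
    relations hold, and if the type determines the orbit. *)
Section Classification.
Variables (k : nat) (T : finType) (type : k.-tuple 'I_(N + N) -> T).

Hypothesis type_fixed : forall (B : cstarAlgType R) (w : 'M[B]_N)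
    (g : T -> R[i]) (xi : {ffun k.-tuple 'I_(N + N) -> R[i]^o}),
  hyperoct_relations w -> (forall i, xi i = g (type i)) ->
  fixed_vector (segment_magic w) xi.

Hypothesis type_orbit : forall i j, type i = type j ->
  forall l m, relpos (tnth i l) (tnth i m) = relpos (tnth j l) (tnth j m).

Lemma classical_fixed_type (xi : {ffun k.-tuple 'I_(N + N) -> R[i]^o}) :
  fixed_vector (segment_magic coord) xi ->
  exists g : T -> R[i], forall i, xi i = g (type i).
Proof.
move=> fix_xi; exists (fun t => if [pick j | type j == t] is Some j then xi j else 0).
move=> i; case: pickP => [j /eqP ji|/(_ i)]; last by rewrite eqxx.
have [g gji] := relpos_orbit (type_orbit ji).
exact/esym/(classical_fixed_invariant fix_xi gji).
Qed.

(** Both fixed spaces lie in the space of H_N-invariant functions, the quantum one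
    because of the morphism given by universality, and both contain the
    functions of the type. *)
Lemma Fix_type (xi : {ffun k.-tuple 'I_(N + N) -> R[i]^o}) :
  (xi \in Fix (segment_magic coord) k <->
     exists g : T -> R[i], forall i, xi i = g (type i)) /\
  (xi \in Fix (segment_magic u) k <->
     exists g : T -> R[i], forall i, xi i = g (type i)).
Proof.
have cl := hyperoct_coord_relations R N.
split; split=> [/mem_Fix|[g xiE]].
- exact: classical_fixed_type.
- exact/mem_Fix/(type_fixed cl xiE).
- by move/free_fixed_classical/classical_fixed_type.
- exact/mem_Fix/(type_fixed hu.1 xiE).
Qed.

Lemma num_orbitals_eq :
  num_orbitals (segment_magic coord) k = num_orbitals (segment_magic u) k.
Proof.
congr (\dim _); apply/vspaceP => xi; have [cP qP] := Fix_type xi.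
by apply/idP/idP => [/cP/qP|/qP/cP].
Qed.

Lemma num_orbitals_type : (forall t, exists i, type i = t) ->
  num_orbitals (segment_magic coord) k = #|T| /\
  num_orbitals (segment_magic u) k = #|T|.
Proof.
by move=> surj; split; apply: (dim_pullback surj) => xi; have [] := Fix_type xi.
Qed.

End Classification.
End NumOrbitals.

Section TypesClassify.
Variable N : nat.

Lemma orbit_type1_relpos (i j : 1.-tuple 'I_(N + N)) : orbit_type1 i = orbit_type1 j ->
  forall l m, relpos (tnth i l) (tnth i m) = relpos (tnth j l) (tnth j m).
Proof. by move=> _ l m; rewrite !ord1 !relposxx. Qed.

Lemma orbit_type2_relpos (i j : 2.-tuple 'I_(N + N)) : orbit_type2 i = orbit_type2 j ->
  forall l m, relpos (tnth i l) (tnth i m) = relpos (tnth j l) (tnth j m).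
Proof.
have [a [b ->]] := tuple2_ex i; have [a' [b' ->]] := tuple2_ex j.
rewrite !orbit_type2E => ab.
case=> [[|[|//]] ?] [[|[|//]] ?]; rewrite !(tnth_nth a) /= ?relposxx //.
by rewrite relposC ab relposC.
Qed.

Lemma orbit_type3_relpos (i j : 3.-tuple 'I_(N + N)) : orbit_type3 i = orbit_type3 j ->
  forall l m, relpos (tnth i l) (tnth i m) = relpos (tnth j l) (tnth j m).
Proof.
have [a [b [c ->]]] := tuple3_ex i; have [a' [b' [c' ->]]] := tuple3_ex j.
move/(congr1 relpos_of_orbit_type3); rewrite !orbit_type3K => -[ab bc ac].
case=> [[|[|[|//]]] ?] [[|[|[|//]]] ?]; rewrite !(tnth_nth a) /= ?relposxx //.
- by rewrite relposC ab relposC.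
- by rewrite relposC ac relposC.
- by rewrite relposC bc relposC.
Qed.

End TypesClassify.

Lemma orbit_type1_surj N : (1 <= N)%N ->
  forall t, exists i : 1.-tuple 'I_(N + N), orbit_type1 i = t.
Proof. by case: N => // n _ []; exists [tuple ord0]. Qed.

Lemma orbit_type2_surj N : (2 <= N)%N ->
  forall t, exists i : 2.-tuple 'I_(N + N), orbit_type2 i = t.
Proof.
case: N => [|[|n]] // _ [b|].
  by exists [tuple endpoint ord0 false; endpoint ord0 b]; rewrite orbit_type2E relpos_endpoint.
exists [tuple endpoint ord0 false; endpoint ord_max false].
by rewrite orbit_type2E relpos_endpoint.
Qed.

Lemma orbit_type3_surj N : (3 <= N)%N ->
  forall t, exists i : 3.-tuple 'I_(N + N), orbit_type3 i = t.
Proof.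
case: N => [|[|[|n]]] // _ t.
pose s0 : 'I_n.+3 := ord0; pose s1 : 'I_n.+3 := lift ord0 ord0; pose s2 : 'I_n.+3 := ord_max.
suff: exists a b c : 'I_(n.+3 + n.+3), orbit_type3 [tuple a; b; c] = t.
  by move=> [a [b [c abc]]]; exists [tuple a; b; c].
case: t => [[[b|] [b'|]]|b].
- exists (endpoint s0 false), (endpoint s0 b), (endpoint s0 (b (+) b')).
  by rewrite orbit_type3E !relpos_endpoint /= addbA addbb.
- exists (endpoint s0 false), (endpoint s0 b), (endpoint s1 false).
  by rewrite orbit_type3E !relpos_endpoint.
- exists (endpoint s0 false), (endpoint s1 false), (endpoint s1 b').
  by rewrite orbit_type3E !relpos_endpoint.
- exists (endpoint s0 false), (endpoint s1 false), (endpoint s2 false).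
  by rewrite orbit_type3E !relpos_endpoint.
- exists (endpoint s0 false), (endpoint s1 false), (endpoint s0 b).
  by rewrite orbit_type3E !relpos_endpoint.
Qed.

Theorem proposition8p5 (R : realType) (N : nat) (A : cstarAlgType R)
    (u : 'M[A]_N) (hu : is_C_free_hyperoct u) :
  [/\ forall k : nat, (1 <= k <= 3)%N ->
        num_orbitals (segment_magic (hyperoct_coord R N)) k =
        num_orbitals (segment_magic u) k,
      (1 <= N)%N ->
        num_orbitals (segment_magic (hyperoct_coord R N)) 1 = 1%N /\
        num_orbitals (segment_magic u) 1 = 1%N,
      (2 <= N)%N ->
        num_orbitals (segment_magic (hyperoct_coord R N)) 2 = 3%N /\
        num_orbitals (segment_magic u) 2 = 3%N
    & (3 <= N)%N ->
        num_orbitals (segment_magic (hyperoct_coord R N)) 3 = 11%N /\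
        num_orbitals (segment_magic u) 3 = 11%N].
Proof.
have fixed1 (B : cstarAlgType R) (w : 'M[B]_N) (g : unit -> R[i])
    (xi : {ffun 1.-tuple 'I_(N + N) -> R[i]^o}) :
    hyperoct_relations w -> (forall i, xi i = g (orbit_type1 i)) ->
    fixed_vector (segment_magic w) xi.
  by move=> hw xiE; apply: (fixed_vector1 hw (g := g tt)).
have fixed2 (B : cstarAlgType R) (w : 'M[B]_N) (g : option bool -> R[i])
    (xi : {ffun 2.-tuple 'I_(N + N) -> R[i]^o}) :
    hyperoct_relations w -> (forall i, xi i = g (orbit_type2 i)) ->
    fixed_vector (segment_magic w) xi.
  by move=> hw xiE; apply: (fixed_vector2 hw (g := g)) => a b; rewrite xiE.
have fixed3 := fun B w g xi hw xiE => @fixed_vector3 R B N w hw g xi xiE.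
split.
- move=> [|[|[|[|k]]]] // _.
  + exact: (num_orbitals_eq hu fixed1 (@orbit_type1_relpos N)).
  + exact: (num_orbitals_eq hu fixed2 (@orbit_type2_relpos N)).
  + exact: (num_orbitals_eq hu fixed3 (@orbit_type3_relpos N)).
- by move/orbit_type1_surj/(num_orbitals_type hu fixed1 (@orbit_type1_relpos N)); rewrite card_unit.
- move/orbit_type2_surj/(num_orbitals_type hu fixed2 (@orbit_type2_relpos N)).
  by rewrite card_option card_bool.
- move/orbit_type3_surj/(num_orbitals_type hu fixed3 (@orbit_type3_relpos N)).
  by rewrite card_sum card_prod card_option card_bool.
Qed.
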